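(* Every forest has a good leaf.
   Context: A simplicial complex $\Delta$ on $[n]=\{1,\ldots,n\}$ is a collection of subsets of $[n]$ (faces) closed under taking subsets; its maximal faces are its facets, and $\mathcal{F}(\Delta)$ is the set of facets. Complexes have at least one facet and their facets are nonempty. A subcomplex of $\Delta$ means a simplicial complex all of whose facets are facets of $\Delta$. A facet $F$ of $\Delta$ is a leaf if either $F$ is the only facet of $\Delta$, or there exists $G\in\mathcal{F}(\Delta)$, $G\ne F$, such that $H\cap F\subseteq G\cap F$ for each $H\in\mathcal{F}(\Delta)$ with $H\ne F$. $\Delta$ is a forest if each subcomplex of $\Delta$ has a leaf. A leaf $F$ of $\Delta$ is a good leaf if $F$ is a leaf of each subcomplex of $\Delta$ to which it belongs (as a facet). *)

(* Defs.v *)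
From mathcomp Require Import all_boot.

Set Implicit Arguments.
Unset Strict Implicit.
Unset Printing Implicit Defensive.

(* The vertex set [n] = {1, ..., n} is represented by 'I_n = {0, ..., n-1}. *)

Definition facets (n : nat) (D : {set {set 'I_n}}) : {set {set 'I_n}} :=
  [set F | maxset (fun A => A \in D) F].

(* The last two clauses are the standing convention that a complex has at
   least one facet and that all its facets are nonempty; they exclude the
   complexes set0 and [set set0]. *)
Definition simplicial_complex (n : nat) (D : {set {set 'I_n}}) : Prop :=
  [/\ forall F G : {set 'I_n}, F \in D -> G \subset F -> G \in D,
      facets D != set0
    & set0 \notin facets D].

(* Stronger than inclusion of faces: the facets of E are facets of D. *)
Definition subcomplex (n : nat) (E D : {set {set 'I_n}}) : Prop :=
  simplicial_complex E /\ facets E \subset facets D.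

Definition leaf (n : nat) (D : {set {set 'I_n}}) (F : {set 'I_n}) : Prop :=
  F \in facets D /\
  (facets D = [set F] \/
   exists G : {set 'I_n},
     [/\ G \in facets D, G != F
       & forall H : {set 'I_n},
           H \in facets D -> H != F -> H :&: F \subset G :&: F]).

Definition forest (n : nat) (D : {set {set 'I_n}}) : Prop :=
  forall E : {set {set 'I_n}}, subcomplex E D -> exists F, leaf E F.

Definition good_leaf (n : nat) (D : {set {set 'I_n}}) (F : {set 'I_n}) : Prop :=
  leaf D F /\
  forall E : {set {set 'I_n}}, subcomplex E D -> F \in facets E -> leaf E F.

(* Main.v *)
Require Import Defs.
From mathcomp Require Import all_boot all_fingroup zify.

(** A facet F is a good leaf exactly when its intersections with the other
    facets form a chain, and such an F is found by ordering the incidence matrix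
    of facets against vertices.

    Number the facets (rows) and the vertices (columns) so that the matrix is
    doubly lexical: read from the last entry backwards, the rows increase
    lexicographically, and so do the columns.  Such numberings f, g exist
    ([doubly_lexical_exists]): take those that maximise the sum of
    2^(f a) * 2^(g x) over the incident pairs (a, x); exchanging two rows that
    are out of order would increase the sum, and likewise for columns.

    In a doubly lexical matrix, suppose that rows a < b and columns x < y carry
    1 at (a, x), (a, y), (b, x) but 0 at (b, y).  The lexicographic comparison of
    a with b yields a later column in b and not in a, that of x with y a later
    row in y and not in x, and repeating this with the new rows and columns grows
    an increasing sequence of rows i_0, i_1, ... and columns j_0, j_1, ... whose
    submatrix has 1 exactly at (0, 0) and next to the diagonal
    ([staircase_step]).  When a 1 appears at a new corner (k, k), the submatrix
    becomes a cycle, each of whose rows meets two other rows in points that no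
    single other row covers: the facets i_0, ..., i_k have no leaf
    ([closed_staircase_leafless]).  In a forest the growth would thus never stop,
    which is absurd.  So the forbidden pattern does not occur
    ([doubly_lexical_gamma_free]), which says for the first facet F that its
    intersection with any facet is a final segment of F; these segments form a
    chain. *)

Set Implicit Arguments.
Unset Strict Implicit.
Unset Printing Implicit Defensive.

(** * Lexicographic comparison through binary weights *)

Section BinaryWeight.
Variables (C : finType) (g : C -> nat).
Hypothesis g_inj : injective g.

Lemma sum_exp2_lt (m : nat) (P : pred C) :
  (forall x, P x -> g x < m) -> \sum_(x | P x) 2 ^ g x < 2 ^ m.
Proof.
elim: m P => [|m IHm] P Pm.
  by rewrite big_pred0 // => x; apply/negP => /Pm.
have lt_m (Q : pred C) : (forall x, Q x -> P x && (g x != m)) ->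
    \sum_(x | Q x) 2 ^ g x < 2 ^ m.
  by move=> QP; apply: IHm => x /QP /andP[/Pm]; lia.
rewrite expnS mul2n -addnn.
have [y /andP[Py /eqP gy]|none] := pickP [pred y | P y && (g y == m)].
  rewrite (bigD1 y) //= gy ltn_add2l; apply: lt_m => x /andP[Px xy].
  by rewrite Px -gy (inj_eq g_inj).
rewrite ltn_addr //; apply: lt_m => x Px.
by move: (none x) => /=; rewrite Px /= => ->.
Qed.

(** The comparison of binary numerals is decided at the highest digit where
    they differ. *)
Lemma exp2_weight_le_lex (A B : pred C) (x : C) :
  \sum_(z | A z) 2 ^ g z <= \sum_(z | B z) 2 ^ g z -> A x -> ~~ B x ->
  exists y, [/\ g x < g y, B y, ~~ A y
              & forall z, g y < g z -> A z = B z].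
Proof.
move=> leAB Ax nBx.
have Dx : A x != B x by rewrite Ax (negPf nBx).
case: (@arg_maxnP _ x (fun z => A z != B z) g Dx) => y Dy ymax.
have above z : g y < g z -> A z = B z.
  move=> yz; apply/eqP; apply: contraTT yz => /ymax; lia.
have le_xy : g x <= g y := ymax x Dx.
case By : (B y); last first.
  have Ay : A y by move: Dy; rewrite By; case: (A y).
  have ltD : \sum_(z | B z && ~~ A z) 2 ^ g z < 2 ^ g y.
    apply: sum_exp2_lt => z /andP[Bz nAz].
    have Dz : A z != B z by rewrite Bz (negPf nAz).
    rewrite ltn_neqAle (inj_eq g_inj) [_ <= _](ymax z Dz) andbT.
    by apply: contraNneq nAz => ->.
  have geD : 2 ^ g y <= \sum_(z | A z && ~~ B z) 2 ^ g z.
    by rewrite (bigD1 y) /= ?Ay ?By // leq_addr.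
  have eqI : \sum_(z | A z && B z) 2 ^ g z = \sum_(z | B z && A z) 2 ^ g z.
    by apply: eq_bigl => z; rewrite andbC.
  move: leAB; rewrite (bigID B A) (bigID A B) /= eqI leq_add2l; lia.
have nAy : ~~ A y by move: Dy; rewrite By; case: (A y).
exists y; split=> //; rewrite ltn_neqAle (inj_eq g_inj) le_xy andbT.
by apply: contraNneq nBx => ->; rewrite By.
Qed.

End BinaryWeight.

(** * Doubly lexical numberings *)

(** Rows numbered by [f] increase lexicographically, the columns being compared
    from the highest number under [g] downwards. *)
Definition rows_lexical (R C : finType) (e : R -> C -> bool)
    (f : R -> nat) (g : C -> nat) : Prop :=
  forall a b x, f a < f b -> e a x -> ~~ e b x ->
  exists y, [/\ g x < g y, e b y, ~~ e a y
              & forall z, g y < g z -> e a z = e b z].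

(** Exchange argument: a numbering that maximises the weighted sum puts the
    heavier rows last. *)
Lemma max_numbering_sorted (R : finType) (r : R -> nat) (p : {perm R}) :
  (forall q : {perm R},
     \sum_a r a * 2 ^ enum_rank (q a) <= \sum_a r a * 2 ^ enum_rank (p a)) ->
  forall a b, enum_rank (p a) < enum_rank (p b) -> r a <= r b.
Proof.
move=> pmax a b lt_ab.
have neq_ba : b != a by apply: contraTneq lt_ab => ->; rewrite ltnn.
have split_ab (F : R -> nat) :
    \sum_c F c = F a + (F b + \sum_(c | (c != a) && (c != b)) F c).
  by rewrite (bigD1 a) // (bigD1 b).
have := pmax (tperm a b * p)%g; rewrite !split_ab !permM tpermL tpermR.
under eq_bigr => c /andP[ca cb] do rewrite permM tpermD 1?eq_sym //.
have : 2 ^ enum_rank (p a) < 2 ^ enum_rank (p b) by rewrite ltn_exp2l.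
move: (\sum_(c | _) _) (2 ^ _) (2 ^ _) => s u v; nia.
Qed.

Lemma doubly_lexical_exists (R C : finType) (e : R -> C -> bool) :
  exists (f : R -> nat) (g : C -> nat),
    [/\ injective f, injective g,
        rows_lexical e f g & rows_lexical (fun x a => e a x) g f].
Proof.
pose num (T : finType) (p : {perm T}) t : nat := enum_rank (p t).
have num_inj (T : finType) (p : {perm T}) : injective (num T p).
  by move=> s t /ord_inj/enum_rank_inj/perm_inj.
pose row q a := \sum_(x | e a x) 2 ^ num C q x.
pose col p x := \sum_(a | e a x) 2 ^ num R p a.
pose W (pq : {perm R} * {perm C}) := \sum_a row pq.2 a * 2 ^ num R pq.1 a.
have W_col p q : W (p, q) = \sum_x col p x * 2 ^ num C q x.
  rewrite /W /=.
  under eq_bigr => a _ do rewrite big_distrl.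
  rewrite (exchange_big_dep predT) //=; apply: eq_bigr => x _.
  by rewrite big_distrl; apply: eq_bigr => a _; rewrite mulnC.
case: (@arg_maxnP _ (1%g, 1%g) predT W isT) => -[p q] _ pqmax.
exists (num R p), (num C q); split=> [||a b x lt_ab|x y a lt_ab];
  try exact: num_inj.
- apply: exp2_weight_le_lex => //.
  by apply: (@max_numbering_sorted _ (row q) p) lt_ab => p'; apply: (pqmax (p', q)).
- apply: (@exp2_weight_le_lex _ _ _ (fun a => e a x) (fun a => e a y)) => //.
  apply: (@max_numbering_sorted _ (col p) q) lt_ab => q'.
  by have := pqmax (p, q') isT; rewrite !W_col.
Qed.

(** * Growing a staircase out of a forbidden pattern *)

Definition stair (a b : nat) : bool :=
  [|| a == b.+1, b == a.+1 | (a == 0) && (b == 0)].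

(** The last clause remembers that column [j a.+2] came from the lexicographic
    comparison of rows [i a] and [i a.+1]: it is their last difference, so that
    all later columns avoid all earlier rows. *)
Definition climbing (R C : finType) (e : R -> C -> bool)
    (f : R -> nat) (g : C -> nat) (k : nat) (i : nat -> R) (j : nat -> C) : Prop :=
  (forall a b, a < b <= k -> f (i a) < f (i b)) /\
  (forall a, a.+2 <= k -> forall z, g (j a.+2) < g z -> e (i a) z = e (i a.+1) z).

Definition staircase (R C : finType) (e : R -> C -> bool)
    (f : R -> nat) (g : C -> nat) (k : nat) (i : nat -> R) (j : nat -> C) : Prop :=
  [/\ climbing e f g k i j, climbing (fun x a => e a x) g f k j i
    & forall a b, a <= k -> b <= k -> e (i a) (j b) = stair a b].

(** The new column is the last difference of the two top rows.  Each earlier row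
    agrees that far out with its successor, so the 0 of row [i k] descends to all
    of them. *)
Lemma staircase_next_column (R C : finType) (e : R -> C -> bool)
    (f : R -> nat) (g : C -> nat) (k : nat) (i : nat -> R) (j : nat -> C) :
  rows_lexical e f g -> staircase e f g k.+1 i j ->
  exists y, [/\ g (j k.+1) < g y, e (i k.+1) y,
              forall a, a <= k -> ~~ e (i a) y
            & forall z, g y < g z -> e (i k) z = e (i k.+1) z].
Proof.
move=> lex [[f_inc agree] [g_inc _] ent].
have [||| y [lt_y ey ney last_y]] := lex (i k) (i k.+1) (j k.+1).
- by apply: f_inc; lia.
- by rewrite ent // /stair; lia.
- by rewrite ent // /stair; lia.
exists y; split=> // a le_ak.
rewrite -(subKn le_ak); elim: (k - a) => [|d IHd]; first by rewrite subn0.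
have [lt_dk | ge_dk] := ltnP d k; last first.
  by have -> : k - d.+1 = k - d by lia.
rewrite agree; [by rewrite subnSK | lia |].
apply: leq_ltn_trans lt_y.
have [->//|neq] := eqVneq (k - d.+1).+2 k.+1.
by apply: ltnW; apply: g_inc; lia.
Qed.

Definition extend (T : Type) (k : nat) (i : nat -> T) (t : T) (a : nat) : T :=
  if a <= k then i a else t.

Lemma climbing_extend (R C : finType) (e : R -> C -> bool)
    (f : R -> nat) (g : C -> nat) (k : nat) (i : nat -> R) (j : nat -> C) b y :
  climbing e f g k.+1 i j -> f (i k.+1) < f b ->
  (forall z, g y < g z -> e (i k) z = e (i k.+1) z) ->
  climbing e f g k.+2 (extend k.+1 i b) (extend k.+1 j y).
Proof.
move=> [f_inc agree] lt_b last_y; rewrite /extend; split=> [a c ac | a ak z].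
  case: (leqP c k.+1) => ck; first by rewrite ifT ?f_inc; lia.
  rewrite ifT; last by lia.
  have [-> //|neq] := eqVneq a k.+1.
  by apply: ltn_trans lt_b; apply: f_inc; lia.
have [-> ->] : a <= k.+1 /\ a < k.+1 by lia.
case: ifP => ak'; first by apply: agree; lia.
have -> : a = k by lia.
exact: last_y.
Qed.

(** The leaf condition of a forest, for a family of sets indexed by [R]. *)
Definition leafy (R C : finType) (e : R -> C -> bool) : Prop :=
  forall A : {set R}, A != set0 -> exists2 F, F \in A &
    A = [set F] \/ exists G, [/\ G \in A, G != F &
      forall H, H \in A -> H != F -> forall x, e H x -> e F x -> e G x].

(** Row [a] of the cycle has its 1s in the columns [a.-1] and [minn a.+1 k]; the
    only other rows through these columns are two different ones. *)
Lemma closed_staircase_leafless (R C : finType) (e : R -> C -> bool)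
    (k : nat) (i : nat -> R) (j : nat -> C) :
  leafy e -> 1 < k ->
  (forall a b, a < b <= k -> i a != i b) ->
  (forall a b, a <= k -> b <= k ->
     e (i a) (j b) = stair a b || (a == k) && (b == k)) ->
  False.
Proof.
move=> lf k_gt1 i_neq ent.
have neq a b : a <= k -> b <= k -> a != b -> i a != i b.
  move=> ak bk; case: (ltngtP a b) => // ab _; last rewrite eq_sym.
    by apply: i_neq; lia.
  by apply: i_neq; lia.
pose A := [set i (a : nat) | a : 'I_k.+1].
have inA a : a <= k -> i a \in A.
  by move=> ak; apply/imsetP; exists (Ordinal (ak : a < k.+1)).
have [|F /imsetP[[a /= ak] _ ->] []] := lf A; first by apply/set0Pn; exists (i 0); apply: inA.
  move=> eqA; have := inA 0 isT; have := inA 1 (ltnW k_gt1).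
  rewrite eqA !inE => /eqP i1 /eqP i0.
  by have := i_neq 0 1; rewrite i0 i1 eqxx; lia.
move=> [G [/imsetP[[b /= bk] _ ->] neq_ba cov]].
have {}neq_ba : b != a by apply: contraNneq neq_ba => ->.
pose cell c d := stair c d || (c == k) && (d == k).
have hit c d : c <= k -> d <= k -> c != a -> cell c d -> cell a d -> cell b d.
  rewrite /cell => ck dk ca; rewrite -!ent //.
  by apply: cov; [apply: inA | apply: neq].
have cell_left : cell b a.-1.
  have [a0|[a1|a2]] : a = 0 \/ a = 1 \/ 1 < a by lia.
  - by apply: (hit 1); rewrite ?/cell ?/stair; lia.
  - by apply: (hit 0); rewrite ?/cell ?/stair; lia.
  - by apply: (hit (a - 2)); rewrite ?/cell ?/stair; lia.
have cell_right : cell b (minn a.+1 k).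
  have [ak2|[ak1|ak0]] : a.+2 <= k \/ a.+1 = k \/ a = k by lia.
  - by apply: (hit a.+2); rewrite ?/cell ?/stair; lia.
  - by apply: (hit k); rewrite ?/cell ?/stair; lia.
  - by apply: (hit k.-1); rewrite ?/cell ?/stair; lia.
move: cell_left cell_right; rewrite /cell /stair; lia.
Qed.

(** The next column and the next row complete the pattern except at their common
    entry; a 1 there would close a cycle. *)
Lemma staircase_step (R C : finType) (e : R -> C -> bool)
    (f : R -> nat) (g : C -> nat) (k : nat) (i : nat -> R) (j : nat -> C) :
  leafy e -> rows_lexical e f g -> rows_lexical (fun x a => e a x) g f ->
  staircase e f g k.+1 i j -> exists i' j', staircase e f g k.+2 i' j'.
Proof.
move=> lf lexr lexc st.
have st' : staircase (fun x a => e a x) g f k.+1 j i.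
  by case: st => cr cc ent; split=> // a b ak bk; rewrite ent // /stair; lia.
have [y [lt_y ey ney last_y]] := staircase_next_column lexr st.
have [b [lt_b eb neb last_b]] := staircase_next_column lexc st'.
case: st => cr cc ent.
pose i' := extend k.+1 i b; pose j' := extend k.+1 j y.
have cr' : climbing e f g k.+2 i' j' by apply: climbing_extend.
have cc' : climbing (fun x a => e a x) g f k.+2 j' i' by apply: climbing_extend.
have ent' a c : a <= k.+2 -> c <= k.+2 ->
    e (i' a) (j' c) = stair a c || [&& a == k.+2, c == k.+2 & e b y].
  move=> ak ck; rewrite /i' /j' /extend.
  case: (leqP a k.+1) => ak'; case: (leqP c k.+1) => ck'.
  - by rewrite ent //; lia.
  - case: (leqP a k) => ak''; first by rewrite (negPf (ney a _)) // /stair; lia.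
    have -> : a = k.+1 by lia.
    by rewrite ey /stair; lia.
  - case: (leqP c k) => ck''; first by rewrite (negPf (neb c _)) // /stair; lia.
    have -> : c = k.+1 by lia.
    by rewrite eb /stair; lia.
  - by rewrite /stair; lia.
case eby : (e b y); last first.
  by exists i', j'; split=> // a c ak ck; rewrite ent' // eby; lia.
case: (@closed_staircase_leafless _ _ e k.+2 i' j') => // [a c ac | a c ak ck].
  have [f_inc _] := cr'; apply: contraTneq (f_inc _ _ ac) => ->.
  by rewrite ltnn.
by rewrite ent' // eby andbT.
Qed.

Lemma doubly_lexical_gamma_free (R C : finType) (e : R -> C -> bool)
    (f : R -> nat) (g : C -> nat) a b x y :
  leafy e -> rows_lexical e f g -> rows_lexical (fun x a => e a x) g f ->
  f a < f b -> g x < g y -> e a x -> e a y -> e b x -> e b y.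
Proof.
move=> lf lexr lexc fab gxy eax eay ebx; apply: contraT => neby.
have grow k : exists i j, staircase e f g k.+1 i j.
  elim: k => [|k [i [j]]]; last exact: staircase_step.
  exists (fun m => if m == 0 then a else b), (fun m => if m == 0 then x else y).
  split; [split=> // | split=> // | ].
  - by move=> [|c] [|d] //= /andP[]; lia.
  - by move=> [|c] [|d] //= /andP[]; lia.
  - by move=> [|[|c]] [|[|d]] //= _ _; apply: negPf.
(* The rows of a staircase are distinct, so its size is at most that of R. *)
have [i [j [[f_inc _] _ _]]] := grow #|R|.
have i_inj : injective (fun m : 'I_#|R|.+2 => i m).
  move=> c d /= eq_cd; apply: val_inj => /=.
  case: (ltngtP c d) => // lt_cd; have := f_inc _ _ _.
    by move/(_ c d); rewrite eq_cd ltnn lt_cd -ltnS ltn_ord => /(_ isT).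
  by move/(_ d c); rewrite eq_cd ltnn lt_cd -ltnS ltn_ord => /(_ isT).
by have := leq_card _ i_inj; rewrite card_ord; lia.
Qed.

(** * Nested traces and good leaves *)

(** The first row of a doubly lexical numbering meets every row in a final
    segment of itself. *)
Lemma leafy_nested_row (R C : finType) (e : R -> C -> bool) (a0 : R) :
  leafy e -> exists a, forall b c,
    (forall x, e a x -> e b x -> e c x) \/ (forall x, e a x -> e c x -> e b x).
Proof.
move=> lf; have [f [g [f_inj g_inj lexr lexc]]] := doubly_lexical_exists e.
case: (@arg_minnP _ a0 predT f isT) => a _ amin; exists a.
have later b x y : g x < g y -> e a x -> e a y -> e b x -> e b y.
  move=> lt_xy ax ay bx; have [<- //|neq_ab] := eqVneq a b.
  apply: (doubly_lexical_gamma_free lf lexr lexc _ lt_xy ax) => //.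
  by rewrite ltn_neqAle (inj_eq f_inj) neq_ab [_ <= _]amin.
move=> b c.
have [/forallP sub|] := boolP [forall x, e a x && e b x ==> e c x].
  by left=> x ax bx; have := sub x; rewrite ax bx.
rewrite negb_forall => /existsP[x]; rewrite negb_imply -andbA => /and3P[ax bx ncx].
right=> y ay cy; case: (ltngtP (g x) (g y)) => [lt_xy | lt_yx | /g_inj <- //].
  exact: later lt_xy ax ay bx.
by rewrite (later c y x) in ncx.
Qed.

Lemma facets_sub (n : nat) (D : {set {set 'I_n}}) (F G : {set 'I_n}) :
  F \in facets D -> G \in facets D -> F \subset G -> F = G.
Proof.
rewrite !inE => /maxsetP[_ Fmax] /maxsetP[DG _] FG.
by rewrite (Fmax G DG FG).
Qed.

Definition generated_complex (n : nat) (S : {set {set 'I_n}}) : {set {set 'I_n}} :=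
  [set A : {set 'I_n} | [exists F in S, A \subset F]].

(** Facets are pairwise incomparable, so every set of facets of a complex is
    the facet set of a subcomplex. *)
Lemma facets_generated (n : nat) (D S : {set {set 'I_n}}) :
  S \subset facets D -> facets (generated_complex S) = S.
Proof.
move=> /subsetP SD; apply/setP => F; rewrite inE; apply/maxsetP/idP => [[]|SF].
  rewrite inE => /exists_inP[G SG FG] Fmax.
  by rewrite -(Fmax G) // inE; apply/exists_inP; exists G.
split=> [|A]; first by rewrite inE; apply/exists_inP; exists F.
rewrite inE => /exists_inP[G SG AG] FA.
have eqFG := facets_sub (SD _ SF) (SD _ SG) (subset_trans FA AG).
by apply/eqP; rewrite eqEsubset FA andbT eqFG.
Qed.

Lemma generated_subcomplex (n : nat) (D S : {set {set 'I_n}}) :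
  simplicial_complex D -> S \subset facets D -> S != set0 ->
  subcomplex (generated_complex S) D.
Proof.
move=> [_ _ D0] SD S0; have facetsE := facets_generated SD.
split; last by rewrite facetsE.
split; rewrite ?facetsE //; last by apply: contra D0; apply: (subsetP SD).
move=> F G; rewrite !inE => /exists_inP[H SH FH] GF.
by apply/exists_inP; exists H => //; apply: subset_trans FH.
Qed.

Lemma forest_leafy (n : nat) (D : {set {set 'I_n}}) :
  simplicial_complex D -> forest D ->
  leafy (fun (F : {F | F \in facets D}) x => x \in val F).
Proof.
move=> cD forD A /set0Pn[F0 AF0]; pose S := val @: A.
have SD : S \subset facets D.
  by apply/subsetP => _ /imsetP[F _ ->]; apply: valP.
have S0 : S != set0 by apply/set0Pn; exists (val F0); apply: imset_f.
have [F []] := forD _ (generated_subcomplex cD SD S0).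
rewrite (facets_generated SD) => /imsetP[F' AF' ->{F}] leafF.
exists F' => //; case: leafF => [eqS | [_ [/imsetP[G AG ->] neqG cov]]].
  by left; apply: (imset_inj val_inj); rewrite imset_set1.
right; exists G; split=> // H AH neqH x Hx Fx.
have /subsetP/(_ x) := cov (val H) (imset_f _ AH) neqH.
by rewrite !inE Hx Fx => /(_ isT) /andP[].
Qed.

(** Among the other facets of a complex, one with the largest trace on [F]
    contains all their traces when these form a chain. *)
Lemma nested_traces_leaf (n : nat) (E : {set {set 'I_n}}) (F : {set 'I_n}) :
  F \in facets E ->
  (forall G H, G \in facets E -> H \in facets E ->
     F :&: G \subset H \/ F :&: H \subset G) ->
  leaf E F.
Proof.
move=> EF nested; split=> //.
have [G0 /andP[EG0 neqG0] | none] := pickP [pred G | (G \in facets E) && (G != F)].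
  right; pose P G := (G \in facets E) && (G != F).
  have P0 : P G0 by rewrite /P EG0.
  case: (@arg_maxnP _ G0 P (fun G => #|G :&: F|) P0) => G /andP[EG neqG] Gmax.
  exists G; split=> // H EH neqH.
  have PH : P H by rewrite /P EH.
  case: (nested H G EH EG) => sub; first by rewrite subsetI subsetIr andbT setIC.
  have sub' : G :&: F \subset H :&: F by rewrite subsetI subsetIr andbT setIC.
  by have /eqP <- : G :&: F == H :&: F by rewrite eqEcard sub' [_ <= _]Gmax.
left; apply/setP => G; rewrite in_set1; apply/idP/eqP => [EG | -> //].
by move: (none G) => /=; rewrite EG /= => /negbFE/eqP.
Qed.

Theorem corollary3p4 (n : nat) (D : {set {set 'I_n}}) :
  simplicial_complex D -> forest D -> exists F : {set 'I_n}, good_leaf D F.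
Proof.
move=> cD forD; have [_ /set0Pn[F0 DF0] _] := cD.
have [[F DF] /= nested] :=
  leafy_nested_row (exist _ F0 DF0) (forest_leafy cD forD).
have leafF E : subcomplex E D -> F \in facets E -> leaf E F.
  move=> [_ /subsetP ED] EF; apply: nested_traces_leaf => // G H EG EH.
  case: (nested (exist _ G (ED G EG)) (exist _ H (ED H EH))) => /= sub.
    by left; apply/subsetP => x; rewrite inE => /andP[]; apply: sub.
  by right; apply/subsetP => x; rewrite inE => /andP[]; apply: sub.
by exists F; split; [apply: leafF | exact: leafF].
Qed.
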